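(* Let $w_{\rm F}=0100101001\dots$ be the infinite Fibonacci word, let $y^+$ be the one-sided infinite word over $\{0,1\}$ obtained from $w_{\rm F}$ by doubling every $0$ (i.e. replacing each letter $0$ by $00$ and leaving each letter $1$ unchanged), and let $Y\subset\{0,1\}^{\mathbb Z}$ be the set of two-sided sequences all of whose finite subwords occur in $y^+$. Then the system $(Y,\sigma)$ is topologically conjugate to the Fibonacci system $(X_\varphi,\sigma)$, but $(Y,\sigma)$ cannot be generated by a substitution: there is no primitive substitution $\eta$ on $\{0,1\}$ with $X_\eta=Y$.
   Context: A substitution $\theta$ on a finite alphabet $A$ is a map from $A$ to non-empty finite words over $A$, extended to words and sequences by concatenation; it is primitive if for some $k\ge1$ every letter occurs in $\theta^k(a)$ for all $a\in A$. For primitive $\theta$, $X_\theta\subset A^{\mathbb Z}$ is the set of two-sided sequences all of whose finite subwords occur in some $\theta^k(a)$, $k\ge1$, $a\in A$; $\sigma$ is the left shift. The Fibonacci substitution is $\varphi:0\mapsto 01,\ 1\mapsto 0$, and $w_{\rm F}$ is its unique one-sided fixed point. Two subshifts $(X,\sigma),(Y,\sigma)$ are topologically conjugate if there is a homeomorphism $\psi:X\to Y$ with $\psi\sigma=\sigma\psi$. *)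

(* Defs.v *)
From HB Require Import structures.
From mathcomp Require Import all_boot all_order all_algebra.
From mathcomp Require Import boolp classical_sets functions topology.

Set Implicit Arguments.
Unset Strict Implicit.
Unset Printing Implicit Defensive.

Import GRing.Theory.

Local Open Scope classical_set_scope.

Record substitution (A : finType) := Substitution {
  subst_letter :> A -> seq A;
  subst_letter_neq0 : forall a, subst_letter a != [::] }.

Definition subst_word (A : finType) (theta : substitution A) (u : seq A) :
  seq A := flatten (map theta u).

Definition subst_pow (A : finType) (theta : substitution A) (k : nat) (a : A) :
  seq A := iter k (subst_word theta) [:: a].

(* The infinite concatenation theta (x 0) ++ theta (x 1) ++ ...; the images of
   letters being non-empty, its letter of index n is already in the image of
   the first n.+1 letters, so that the default value x 0 is never used. *)
Definition subst_seq (A : finType) (theta : substitution A) (x : nat -> A) :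
  nat -> A := fun n => nth (x 0) (subst_word theta (mkseq x n.+1)) n.

Definition primitive (A : finType) (theta : substitution A) : Prop :=
  exists2 k, 0 < k & forall a b : A, b \in subst_pow theta k a.

(* The space A^Z with the product of the discrete topologies. *)
Notation fullshift A := {ptws int -> discrete_topology A}.

Definition shift (A : finType) (x : fullshift A) : fullshift A :=
  fun i => x (i + 1)%R.

(* The subword of length n starting at index i. *)
Definition subword (A : finType) (x : fullshift A) (i : int) (n : nat) :
  seq A := mkseq (fun k => x (i + k%:Z)%R) n.

Definition subshift_of (A : finType) (L : set (seq A)) : set (fullshift A) :=
  [set x | forall i n, L (subword x i n)].

Definition subst_language (A : finType) (theta : substitution A) :
  set (seq A) :=
  [set u | exists k a, 0 < k /\ infix u (subst_pow theta k a)].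

Definition subst_subshift (A : finType) (theta : substitution A) :
  set (fullshift A) := subshift_of (subst_language theta).

Definition seq_language (A : finType) (y : nat -> A) : set (seq A) :=
  [set u | exists m, u = mkseq (fun k => y (m + k)) (size u)].

(* Only the values of psi on X and of psi' on Y matter; both sets carry the
   subspace topology. *)
Definition homeomorphism (S T : topologicalType) (X : set S) (Y : set T)
    (psi : S -> T) (psi' : T -> S) : Prop :=
  [/\ set_fun X Y psi, set_fun Y X psi',
      (forall x, X x -> psi' (psi x) = x) /\
      (forall y, Y y -> psi (psi' y) = y),
      {within X, continuous psi} & {within Y, continuous psi'}].

Definition topologically_conjugate (A B : finType)
    (X : set (fullshift A)) (Y : set (fullshift B)) : Prop :=
  exists psi psi', homeomorphism X Y psi psi' /\
    forall x, X x -> psi (shift x) = shift (psi x).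

(* The alphabet {0, 1} is bool, with 0 = false and 1 = true. *)

Definition fib_letter (a : bool) : seq bool :=
  if a then [:: false] else [:: false; true].

Lemma fib_letter_neq0 a : fib_letter a != [::].
Proof. by case: a. Qed.

Definition fib : substitution bool := Substitution fib_letter_neq0.

(* The limit of the words fib^n(0), the n-th of which has more than n letters;
   fib_wordP below shows that it is the unique fixed point of fib. *)
Definition fib_word : nat -> bool := fun n => nth false (subst_pow fib n false) n.

Definition double0_letter (a : bool) : seq bool :=
  if a then [:: true] else [:: false; false].

Lemma double0_letter_neq0 a : double0_letter a != [::].
Proof. by case: a. Qed.

Definition double0 : substitution bool := Substitution double0_letter_neq0.

Definition fib_doubled_word : nat -> bool := subst_seq double0 fib_word.

Definition fib_doubled_subshift : set (fullshift bool) :=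
  subshift_of (seq_language fib_doubled_word).

Lemma size_subst_word (A : finType) (theta : substitution A) u :
  size u <= size (subst_word theta u).
Proof.
elim: u => //= a u IH; rewrite /subst_word /= size_cat -add1n leq_add //.
by rewrite lt0n size_eq0 subst_letter_neq0.
Qed.

Lemma prefix_subst_word (A : finType) (theta : substitution A) u v :
  prefix u v -> prefix (subst_word theta u) (subst_word theta v).
Proof.
by case/prefixP => s ->; rewrite /subst_word map_cat flatten_cat prefix_prefix.
Qed.

Lemma nth_prefix (T : eqType) (d : T) u v i :
  prefix u v -> i < size u -> nth d v i = nth d u i.
Proof. by case/prefixP => s -> lt_iu; rewrite nth_cat lt_iu. Qed.

Lemma prefix_mkseq (T : eqType) (x : nat -> T) m n :
  m <= n -> prefix (mkseq x m) (mkseq x n).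
Proof.
by move=> le_mn; rewrite -(subnKC le_mn) /mkseq iotaD map_cat prefix_prefix.
Qed.

Lemma subst_powS (A : finType) (theta : substitution A) k a :
  subst_pow theta k.+1 a = subst_word theta (subst_pow theta k a).
Proof. by []. Qed.

Lemma fib_pow_prefixS n :
  prefix (subst_pow fib n false) (subst_pow fib n.+1 false).
Proof. by elim: n => // n IH; rewrite !subst_powS prefix_subst_word. Qed.

Lemma fib_pow_prefix m n :
  m <= n -> prefix (subst_pow fib m false) (subst_pow fib n false).
Proof.
move=> le_mn; rewrite -(subnKC le_mn); elim: (n - m) => [|k IH].
  by rewrite addn0 prefix_refl.
by rewrite addnS (prefix_trans IH) // fib_pow_prefixS.
Qed.

Lemma size_fib_pow n : n < size (subst_pow fib n false).
Proof.
elim: n => // n IH.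
have [s Es] : exists s, subst_pow fib n false = false :: s.
  by have /prefixP[s ->] := fib_pow_prefix (leq0n n); exists s.
rewrite subst_powS; rewrite Es /= in IH *; rewrite /subst_word /= !ltnS.
exact: leq_trans (IH : n <= size s) (size_subst_word fib s).
Qed.

Lemma fib_word_nth n i : i < size (subst_pow fib n false) ->
  nth false (subst_pow fib n false) i = fib_word i.
Proof.
move=> lt_i; rewrite /fib_word; have [le_in|/ltnW le_ni] := leqP i n.
  by rewrite (nth_prefix _ (fib_pow_prefix le_in)) // size_fib_pow.
by rewrite (nth_prefix _ (fib_pow_prefix le_ni)).
Qed.

Lemma subst_seq_nth (A : finType) (theta : substitution A) x d m i :
  i < size (subst_word theta (mkseq x m)) ->
  nth d (subst_word theta (mkseq x m)) i = subst_seq theta x i.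
Proof.
have lt_i : i < size (subst_word theta (mkseq x i.+1)).
  by rewrite (leq_trans _ (size_subst_word _ _)) ?size_mkseq.
move=> lt_im; rewrite /subst_seq (set_nth_default (x 0)) //.
have [le_mi|le_im] := leqP m i.+1.
  by rewrite (nth_prefix _ (prefix_subst_word theta (prefix_mkseq x le_mi))).
rewrite (nth_prefix _ (prefix_subst_word theta (prefix_mkseq x (ltnW le_im))))//.
Qed.

Lemma fib_wordP (w : nat -> bool) : subst_seq fib w = w <-> w = fib_word.
Proof.
split=> [fix_w|->].
  have w0 : w 0 = false.
    by move/(congr1 (@^~ 0)): fix_w; rewrite /subst_seq /subst_word /=; case: (w 0).
  have pow_w n : subst_pow fib n false = mkseq w (size (subst_pow fib n false)).
    elim: n => [|n IH]; first by rewrite /= /mkseq /= w0.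
    rewrite subst_powS {1}IH; apply: (@eq_from_nth _ false).
      by rewrite size_mkseq -IH.
    move=> i lt_i; rewrite subst_seq_nth // fix_w nth_mkseq //.
    by rewrite [in X in _ < X]IH.
  by apply/funext => n; rewrite /fib_word pow_w nth_mkseq ?size_fib_pow.
apply/funext => n.
have pow_fib : subst_pow fib n false
    = mkseq fib_word (size (subst_pow fib n false)).
  apply: (@eq_from_nth _ false) => [|i lt_i]; first by rewrite size_mkseq.
  by rewrite fib_word_nth // nth_mkseq.
have lt_n : n < size (subst_pow fib n.+1 false) by apply/ltnW/size_fib_pow.
rewrite -(fib_word_nth lt_n) subst_powS pow_fib subst_seq_nth //.
by rewrite -pow_fib -subst_powS.
Qed.

(* Main.v *)
Require Import Defs.
From mathcomp Require Import all_boot all_order all_algebra zify.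
From mathcomp Require Import boolp classical_sets functions topology.

Set Implicit Arguments.
Unset Strict Implicit.
Unset Printing Implicit Defensive.

(** With w the Fibonacci word and y its doubling, w is the image of itself under
    0 -> 010, 1 -> 01 and y is the image of w under 0 -> 001, 1 -> 00, with the
    same cutting points, which can be read off locally in either word; this
    gives mutually inverse sliding block codes between the two subshifts.

    If a primitive eta generated the doubled subshift, then, since 0000 occurs
    there, the fourth power of eta^k(0) would occur in y for some k such that
    eta^k(0) contains 1.  Such a power desubstitutes to a repetition of exponent
    at least 4 - 1/n, of period n, in w.  Desubstituting by fib preserves such
    repetitions and strictly decreases n, so that w contains none. *)

(** * Cutting points of the images of the Fibonacci word *)

Lemma mkseq_subst_seq (A : finType) (theta : substitution A) (x : nat -> A) n :
  mkseq (subst_seq theta x) (size (subst_word theta (mkseq x n))) =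
  subst_word theta (mkseq x n).
Proof.
apply: (@eq_from_nth _ (x 0)) => [|i]; rewrite size_mkseq // => lt_i.
by rewrite nth_mkseq // subst_seq_nth.
Qed.

(* The place where the image of the letter of index j starts in the image of the
   Fibonacci word by a substitution with |theta(0)| = d + 1 and |theta(1)| = d:
   fib for d = 1; fib^2 and double0 \o fib for d = 2. *)
Definition cut d j := \sum_(i < j) (d + ~~ fib_word i).

Lemma cutS d j : cut d j.+1 = cut d j + d + ~~ fib_word j.
Proof. by rewrite /cut big_ord_recr /= addnA. Qed.

Lemma cut_block d (z : nat -> bool) (b : bool -> seq bool) :
  (forall a, size (b a) = d + ~~ a) ->
  (forall n, let u := flatten (map b (mkseq fib_word n)) in
     mkseq z (size u) = u) ->
  forall j r, r < d + ~~ fib_word j ->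
    z (cut d j + r) = nth false (b (fib_word j)) r.
Proof.
move=> size_b z_b j r lt_r.
have flattenS n : flatten (map b (mkseq fib_word n.+1)) =
    flatten (map b (mkseq fib_word n)) ++ b (fib_word n).
  by rewrite mkseqS map_rcons flatten_rcons.
have size_cut n : size (flatten (map b (mkseq fib_word n))) = cut d n.
  elim: n => [|n IH]; first by rewrite /cut big_ord0.
  by rewrite flattenS size_cat IH cutS size_b addnA.
have := congr1 (fun s => nth false s (cut d j + r)) (z_b j.+1).
cbv zeta; rewrite flattenS nth_cat size_cat !size_cut size_b nth_mkseq ?ltn_add2l //.
by rewrite [_ + r < _]ltnNge leq_addr /= addKn.
Qed.

Lemma mkseq_fib_word n :
  let u := subst_word fib (mkseq fib_word n) in mkseq fib_word (size u) = u.
Proof.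
have [_ fibE] := fib_wordP fib_word.
by rewrite /= -[X in mkseq X _ = _](fibE erefl) mkseq_subst_seq.
Qed.

Lemma fib_word_cut1 j r : r < 1 + ~~ fib_word j ->
  fib_word (cut 1 j + r) = (r == 1).
Proof.
move=> lt_r; rewrite (@cut_block 1 fib_word fib) //; first last.
- exact: mkseq_fib_word.
- by case.
by move: lt_r; case: (fib_word j); case: r => [|[|]].
Qed.

Lemma flatten_map_subst (theta eta : substitution bool) s :
  flatten [seq subst_word theta (eta a) | a <- s] =
  subst_word theta (subst_word eta s).
Proof.
by elim: s => //= a s ->; rewrite /subst_word /= map_cat flatten_cat.
Qed.

Lemma fib_word_cut2 j r : r < 2 + ~~ fib_word j ->
  fib_word (cut 2 j + r) = (r == 1).
Proof.
move=> lt_r; rewrite (@cut_block 2 fib_word (fun a => subst_word fib (fib a))) //.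
- by move: lt_r; case: (fib_word j); case: r => [|[|[|]]].
- by case.
- move=> n; rewrite flatten_map_subst; have := mkseq_fib_word n; cbv zeta => <-.
  exact: mkseq_fib_word.
Qed.

Lemma doubled_cut2 j r : r < 2 + ~~ fib_word j ->
  fib_doubled_word (cut 2 j + r) = (r == 2).
Proof.
move=> lt_r.
rewrite (@cut_block 2 fib_doubled_word (fun a => subst_word Defs.double0 (fib a))) //.
- by move: lt_r; case: (fib_word j); case: r => [|[|[|]]].
- by case.
- move=> n; rewrite flatten_map_subst; have := mkseq_fib_word n; cbv zeta => <-.
  exact: mkseq_subst_seq.
Qed.

Lemma cut_cover d p : 0 < d ->
  exists j r, p = cut d j + r /\ r < d + ~~ fib_word j.
Proof.
move=> d_gt0; elim: p => [|p [j [r [-> lt_r]]]].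
  by exists 0, 0; rewrite /cut big_ord0; split=> //; lia.
case: (ltnP r.+1 (d + ~~ fib_word j)) => [lt_r1|le_r].
  by exists j, r.+1; split; first lia.
by exists j.+1, 0; rewrite cutS; split; lia.
Qed.

Lemma fib_word_no11 i : fib_word i -> fib_word i.+1 = false.
Proof.
have [j [r [-> lt_r]]] := @cut_cover 1 i isT.
rewrite fib_word_cut1 // => /eqP r1; subst r.
have -> : (cut 1 j + 1).+1 = cut 1 j.+1 + 0 by rewrite cutS; lia.
by rewrite fib_word_cut1 ?addn0.
Qed.

(** Both blocks begin with [d] zeros and only the image of 0 goes on with a 1. After the image of 1,
    offset [d] falls on the first letter of the next block, a 0 because [d > 0]. *)
Lemma fib_word_cut d z j : 0 < d ->
  (forall j r, r < d + ~~ fib_word j -> z (cut d j + r) = (r == d)) ->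
  z (cut d j + d) = ~~ fib_word j.
Proof.
move=> d_gt0 z_cut; case Dw: (fib_word j); last by rewrite z_cut ?eqxx ?Dw; lia.
have -> : cut d j + d = cut d j.+1 + 0 by rewrite cutS Dw; lia.
by rewrite z_cut; lia.
Qed.

(** * Powers in the Fibonacci word and in its doubling *)

Lemma leq_cut d i j : i <= j -> cut d i <= cut d j.
Proof.
move=> /subnKC <-; elim: (j - i) => [|k IH]; first by rewrite addn0.
by rewrite addnS cutS; lia.
Qed.

Lemma leq_cut_add d i k : 0 < d -> cut d i + k <= cut d (i + k).
Proof.
move=> d_gt0; elim: k => [|k IH]; first by rewrite !addn0.
by rewrite [i + k.+1]addnS cutS; lia.
Qed.

Lemma leq_cut2 d j : cut d j + (d + d).+1 <= cut d j.+2.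
Proof.
by rewrite !cutS; case Dw: (fib_word j); rewrite ?(fib_word_no11 Dw); lia.
Qed.

(* A repetition of exponent nearly 4 in a substitutive image of the Fibonacci
   word, starting at a cut, desubstitutes to a shorter one: since 11 does not
   occur, the last two blocks of the repetition have at least [2 * d + 1]
   letters, hence [d] missing letters cost only one letter upstairs. *)
Lemma desubst_period d (z : nat -> bool) j0 n n' : 0 < d -> 0 < n' ->
  (forall j, z (cut d j + d) = ~~ fib_word j) ->
  cut d j0 + n = cut d (j0 + n') ->
  (forall i, i + d < 3 * n -> z (cut d j0 + i) = z (cut d j0 + i + n)) ->
  n' < n /\
  forall i, i + 1 < 3 * n' -> fib_word (j0 + i) = fib_word (j0 + i + n').
Proof.
move=> d_gt0 n'_gt0 zd cut_n per.
(* Offset [d] after a cut reveals the letter upstairs, so it is enough to compare [z] there at two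
   cuts lying [n] apart. *)
have step k : cut d (j0 + k) + n = cut d (j0 + k + n') ->
    cut d (j0 + k) + d + d < cut d j0 + 3 * n ->
    fib_word (j0 + k) = fib_word (j0 + k + n').
  move=> cut_k lt_k; apply: negb_inj; rewrite -!zd -cut_k.
  have le_k : cut d j0 <= cut d (j0 + k) by apply: leq_cut; lia.
  have := per (cut d (j0 + k) + d - cut d j0).
  have -> : cut d j0 + (cut d (j0 + k) + d - cut d j0) = cut d (j0 + k) + d by lia.
  by move=> ->; first congr (z _); lia.
have cut_next k : cut d (j0 + k) + n = cut d (j0 + k + n') ->
    fib_word (j0 + k) = fib_word (j0 + k + n') ->
    cut d (j0 + k.+1) + n = cut d (j0 + k.+1 + n').
  by move=> cut_k eq_k; rewrite addnS addSn !cutS -cut_k eq_k; lia.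
(* For [n' = 1] the letter at [j0] is repeated, hence is 0, which forces [n = d + 1]. *)
have [n'1|n'_gt1] : n' = 1 \/ 1 < n' by lia.
  subst n'; have := cutS d j0; rewrite -addn1 -cut_n => Dn.
  have w0 : fib_word (j0 + 0) = fib_word (j0 + 0 + 1).
    by apply: step; rewrite addn0 //; lia.
  have w0F : fib_word j0 = false.
    apply/negP => w1; move: w0; rewrite addn0 w1 addn1.
    by rewrite (fib_word_no11 w1).
  rewrite w0F /= in Dn; split; first by lia.
  case=> [|[|i]] lt_i; [exact: w0| |by lia].
  apply: step; last by rewrite -cut_n; lia.
  by apply: (@cut_next 0) => //; rewrite addn0.
split.
  have := @leq_cut_add d j0.+2 (n' - 2) d_gt0; have := leq_cut2 d j0.
  have -> : j0.+2 + (n' - 2) = j0 + n' by lia.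
  by rewrite -cut_n; lia.
(* Blocks [k] and [k + 1] provide the slack of [2 * d + 1] letters. To bound their end, [k.+2] is
   moved back by whole periods to an index at most [k], where the cuts are known to repeat; this
   uses [n' > 1]. *)
have lt3 k : k + 1 < 3 * n' ->
    (forall l, l <= k -> cut d (j0 + l) + n = cut d (j0 + l + n')) ->
    cut d (j0 + k) + d + d < cut d j0 + 3 * n.
  move=> lt_k eqs; suff : cut d (j0 + k).+2 <= cut d j0 + 3 * n.
    by have := leq_cut2 d (j0 + k); lia.
  have [le1|gt1] := leqP k.+2 n'.
    have : cut d (j0 + k).+2 <= cut d (j0 + n') by apply: leq_cut; lia.
    by lia.
  have [le2|gt2] := leqP k.+2 (n' + n').
    have -> : (j0 + k).+2 = j0 + (k.+2 - n') + n' by lia.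
    have : cut d (j0 + (k.+2 - n')) <= cut d (j0 + n') by apply: leq_cut; lia.
    by rewrite -eqs; lia.
  have -> : (j0 + k).+2 = j0 + (k.+2 - n' - n') + n' + n' by lia.
  have : cut d (j0 + (k.+2 - n' - n')) <= cut d (j0 + n') by apply: leq_cut; lia.
  have := eqs (k.+2 - n'); have := eqs (k.+2 - n' - n').
  have -> : j0 + (k.+2 - n' - n') + n' = j0 + (k.+2 - n') by lia.
  by lia.
have eqs k : k < 3 * n' -> forall l, l <= k ->
    cut d (j0 + l) + n = cut d (j0 + l + n').
  elim: k => [|k IH] lt_k l.
    by rewrite leqn0 => /eqP ->; rewrite !addn0.
  rewrite leq_eqVlt => /predU1P[->|]; last by apply: IH; lia.
  have IHk := IH (ltnW lt_k).
  apply: cut_next; first exact: IHk.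
  by apply: step; [exact: IHk|apply: lt3 => //; lia].
by move=> i lt_i; apply: step; [apply: (eqs i)|apply: lt3 => //; apply: eqs]; lia.
Qed.

Lemma fib_word_false_cut p : fib_word p = false -> exists j, p = cut 1 j.
Proof.
have [j [r [-> lt_r]]] := @cut_cover 1 p isT.
rewrite fib_word_cut1 // => r1; exists j.
by case: r r1 lt_r => [|[|]] //; lia.
Qed.

Lemma cut_ltn d i j : cut d i < cut d j -> i < j.
Proof. by rewrite !ltnNge; apply: contra; exact: leq_cut. Qed.

(** Descent on [n]: every 0 starts a block of [fib], so a repetition starting with 0 has its first
    two copies starting at cuts, and [desubst_period] applies. *)
Lemma fib_word_no_power p n : 0 < n ->
  ~ (forall i, i + 1 < 3 * n -> fib_word (p + i) = fib_word (p + i + n)).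
Proof.
elim/ltn_ind: n p => n IH p n_gt0 per.
(* If the repetition starts with 1, the letters before its first two copies are both 0, as 11 does
   not occur, so it can be shifted left by one. *)
wlog wp : p per / fib_word p = false.
  move=> W; case wp: (fib_word p); last exact: W wp.
  case: p => [|p] in per wp *; first by rewrite -[0]/(0 + 0) in wp.
  have wnp q : fib_word q.+1 -> fib_word q = false.
    by move=> wq; apply/negP => /fib_word_no11; rewrite wq.
  apply: (W p) (wnp _ wp) => -[|i] lt_i; last first.
    by rewrite addnS -addSn per; last lia.
  rewrite addn0 (wnp _ wp) wnp // -addSn.
  by have := per 0; rewrite addn0 => <-; rewrite ?wp; lia.
have [j0 Dp] := fib_word_false_cut wp.
have [j1 Dp1] : exists j, p + n = cut 1 j.
  by apply: fib_word_false_cut; have := per 0; rewrite addn0 wp => <-; lia.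
have lt_j : j0 < j1 by apply: (@cut_ltn 1); lia.
have [] := @desubst_period 1 fib_word j0 n (j1 - j0) isT.
- by lia.
- by move=> j; apply: fib_word_cut => // *; apply: fib_word_cut1.
- by rewrite subnKC ?(ltnW lt_j) -?Dp.
- by rewrite -Dp.
by move=> lt_n; apply: IH; lia.
Qed.

Lemma doubled_cut2d j : fib_doubled_word (cut 2 j + 2) = ~~ fib_word j.
Proof. by apply: fib_word_cut => // *; apply: doubled_cut2. Qed.

Lemma doubled_true_cut q : fib_doubled_word q ->
  exists2 j, q = cut 2 j + 2 & fib_word j = false.
Proof.
have [j [r [-> lt_r]]] := @cut_cover 2 q isT.
rewrite doubled_cut2 // => /eqP r2; subst r; exists j => //.
by case: (fib_word j) lt_r.
Qed.

(** Moving the start to the next cut costs at most two letters, which [desubst_period] allows for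
    [d = 2]. Without a 1 in the period, 0000 would be a counterexample. *)
Lemma doubled_no_power m n :
  (exists2 i, i < n & fib_doubled_word (m + i)) ->
  ~ (forall i, i < 3 * n ->
       fib_doubled_word (m + i) = fib_doubled_word (m + i + n)).
Proof.
case=> i0 lt_i0 y_i0 per.
(* A 1 ends a block 001 and the next block starts with 00, so periods 1 and 2 are impossible. *)
have n_ge3 : 2 < n.
  have := per i0; rewrite y_i0 => /(_ ltac:(lia)).
  have [j -> wj] := doubled_true_cut y_i0.
  have y0 := @doubled_cut2 j.+1 0 isT; have y1 := @doubled_cut2 j.+1 1 isT.
  rewrite cutS wj /= in y0 y1; have [//|n1|n2] : [\/ 2 < n, n = 1 | n = 2].
  - by case: (n) lt_i0 => [|[|[|]]] // *; [apply: Or32|apply: Or33|apply: Or31].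
  - by rewrite n1 -[cut 2 j + 2 + 1]addn0 y0.
  - by rewrite n2 (_ : _ + 2 + 2 = cut 2 j + 2 + 1 + 1) ?y1; lia.
have [j0 [le_m le_p]] : exists j0, m <= cut 2 j0 /\ cut 2 j0 <= m + 2.
  have [j [[|r] [-> lt_r]]] := @cut_cover 2 m isT; first by exists j; lia.
  by exists j.+1; rewrite cutS; lia.
have per' i : i + 2 < 3 * n -> fib_doubled_word (cut 2 j0 + i) =
    fib_doubled_word (cut 2 j0 + i + n).
  move=> lt_i; have := per (cut 2 j0 - m + i).
  by rewrite addnA subnKC // => -> //; lia.
(* The first 1 after the cut locates its translate by [n]. If the first block is 00, that 1 ends the
   second block, and the block before its translate must also be 00: a block 001 would put a 1 where
   the translate has a 0. *)
have [j1 Dp1] : exists j1, cut 2 j0 + n = cut 2 j1.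
  case w0: (fib_word j0); last first.
    have : fib_doubled_word (cut 2 j0 + 2 + n).
      by rewrite -per' ?doubled_cut2d ?w0 //; lia.
    by case/doubled_true_cut => j ? _; exists j; lia.
  have w1 := fib_word_no11 w0.
  have S1 : cut 2 j0.+1 = cut 2 j0 + 2 by rewrite cutS w0; lia.
  have y4 : fib_doubled_word (cut 2 j0 + 4).
    have -> : cut 2 j0 + 4 = cut 2 j0.+1 + 2 by lia.
    by rewrite doubled_cut2d w1.
  have : fib_doubled_word (cut 2 j0 + 4 + n) by rewrite -per' //; lia.
  case/doubled_true_cut => -[|j] Dj wj.
    by rewrite /cut big_ord0 in Dj; lia.
  exists j; rewrite cutS in Dj; case wj': (fib_word j) Dj => /= Dj; first by lia.
  have := doubled_cut2d j; rewrite wj'.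
  have -> : cut 2 j + 2 = cut 2 j0 + 1 + n by lia.
  by rewrite -per' ?doubled_cut2 ?w0 //; lia.
have lt_j : j0 < j1 by apply: (@cut_ltn 2); lia.
have [] := @desubst_period 2 fib_doubled_word j0 n (j1 - j0) isT.
- by lia.
- exact: doubled_cut2d.
- by rewrite subnKC ?(ltnW lt_j).
- exact: per'.
by move=> _; apply: fib_word_no_power; lia.
Qed.

(** * Local rules between the two words *)

(** Blocks 010 and 01 of the Fibonacci word face 001 and 00. As every block starts with 01, the word
    100 occurs exactly at offset 1 of the long blocks, one place before the 1 of 001. *)
Lemma doubled_code i : fib_doubled_word i.+1 =
  [&& fib_word i, ~~ fib_word i.+1 & ~~ fib_word i.+2].
Proof.
have [j [r [-> lt_r]]] := @cut_cover 2 i isT.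
have wS k : k < 2 ->
    fib_word (cut 2 j + (2 + ~~ fib_word j + k)) = (k == 1).
  by move=> lt_k; rewrite !addnA -cutS fib_word_cut2 //; lia.
have yS : fib_doubled_word (cut 2 j + (2 + ~~ fib_word j + 0)) = false.
  by rewrite !addnA -cutS doubled_cut2 //; lia.
have w0 k : k < 2 + ~~ fib_word j -> fib_word (cut 2 j + k) = (k == 1).
  exact: fib_word_cut2.
have y0 k : k < 2 + ~~ fib_word j -> fib_doubled_word (cut 2 j + k) = (k == 2).
  exact: doubled_cut2.
rewrite -!addnS; case wj: (fib_word j) lt_r wS yS w0 y0 => /= lt_r wS yS w0 y0.
  have w2 : fib_word (cut 2 j + 2) = false := wS 0 isT.
  have w3 : fib_word (cut 2 j + 3) = true := wS 1 isT.
  have y2 : fib_doubled_word (cut 2 j + 2) = false := yS.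
  by case: r lt_r => [|[|]] // _; rewrite ?w2 ?w3 ?y2 ?w0 ?y0 //; lia.
have w3 : fib_word (cut 2 j + 3) = false := wS 0 isT.
have w4 : fib_word (cut 2 j + 4) = true := wS 1 isT.
have y3 : fib_doubled_word (cut 2 j + 3) = false := yS.
by case: r lt_r => [|[|[|]]] // _; rewrite ?w3 ?w4 ?y3 ?w0 ?y0 //; lia.
Qed.

(** The 1 at offset 1 of a long block is seen from the 1 next to it in 001. In a short block it is
    seen from the 1 of the next block, which is long as 11 does not occur; [~~ fib_doubled_word i]
    excludes the end of a long block followed by another. *)
Lemma fib_word_code i : fib_word i =
  fib_doubled_word i.+1 || (fib_doubled_word i.+3 && ~~ fib_doubled_word i).
Proof.
have [j [r [-> lt_r]]] := @cut_cover 2 i isT.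
have yS k : k < 2 ->
    fib_doubled_word (cut 2 j + (2 + ~~ fib_word j + k)) = false.
  by move=> lt_k; rewrite !addnA -cutS doubled_cut2; lia.
have y2S : fib_doubled_word (cut 2 j + (2 + ~~ fib_word j + 2)) =
    ~~ fib_word j.+1 by rewrite !addnA -cutS doubled_cut2d.
have w0 k : k < 2 + ~~ fib_word j -> fib_word (cut 2 j + k) = (k == 1).
  exact: fib_word_cut2.
have y0 k : k < 2 + ~~ fib_word j -> fib_doubled_word (cut 2 j + k) = (k == 2).
  exact: doubled_cut2.
rewrite -!addnS.
case wj: (fib_word j) lt_r yS y2S w0 y0 => /= lt_r yS y2S w0 y0.
  have y2 : fib_doubled_word (cut 2 j + 2) = false := yS 0 isT.
  have y3 : fib_doubled_word (cut 2 j + 3) = false := yS 1 isT.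
  have y4 : fib_doubled_word (cut 2 j + 4) = true.
    by apply: etrans y2S _; rewrite (fib_word_no11 wj).
  by case: r lt_r => [|[|]] // _; rewrite ?y2 ?y3 ?y4 ?w0 ?y0 //; lia.
have y3 : fib_doubled_word (cut 2 j + 3) = false := yS 0 isT.
have y4 : fib_doubled_word (cut 2 j + 4) = false := yS 1 isT.
rewrite (y0 _ lt_r); case: r lt_r => [|[|[|]]] // _;
  by rewrite ?y3 ?y4 ?andbF ?w0 ?y0.
Qed.

Local Open Scope classical_set_scope.

(** * The topological conjugacy *)

Lemma seq_subshiftP (A : finType) (z : nat -> A) (x : fullshift A) :
  subshift_of (seq_language z) x <->
  forall i n, exists m, forall k, k < n -> x (i + k%:Z)%R = z (m + k).
Proof.
split=> zx i n.
  have [m] := zx i n; rewrite size_mkseq => eq_m; exists m => k lt_k.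
  by have := congr1 (nth (x 0%R) ^~ k) eq_m; rewrite !nth_mkseq.
have [m eq_m] := zx i n; exists m; rewrite size_mkseq.
by apply/eq_in_map => k; rewrite mem_iota => /eq_m.
Qed.

Lemma mkseq_fib_pow k :
  subst_pow fib k false = mkseq fib_word (size (subst_pow fib k false)).
Proof.
apply: (@eq_from_nth _ false) => [|i lt_i]; first by rewrite size_mkseq.
by rewrite fib_word_nth // nth_mkseq.
Qed.

Lemma seq_language_infix (A : finType) (z : nat -> A) u v :
  infix u v -> seq_language z v -> seq_language z u.
Proof.
case/infixP=> p [s ->] [m]; rewrite !size_cat /mkseq !iotaD !map_cat.
move/eqP; rewrite eqseq_cat ?size_map ?size_iota // => /andP[_].
rewrite eqseq_cat ?size_map ?size_iota // => /andP[/eqP Du _].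
exists (m + size p); rewrite {1}Du add0n -[in LHS](addn0 (size p)) iotaDl -map_comp.
by apply: eq_map => k /=; rewrite addnA.
Qed.

(** The words fib^k(0) are arbitrarily long prefixes of the Fibonacci word, and fib^(k+1)(1) =
    fib^k(0). *)
Lemma fib_language : subst_language fib = seq_language fib_word.
Proof.
apply/seteqP; split=> u.
  have pow_lang k : seq_language fib_word (subst_pow fib k false).
    by exists 0; rewrite -mkseq_fib_pow.
  case=> -[|k] [[] []] // _ infix_u; apply: seq_language_infix infix_u _ => //.
  by rewrite /subst_pow iterSr; exact: pow_lang.
case=> m Du; exists (m + size u).+1, false; split=> //.
rewrite mkseq_fib_pow; set N := size _.
have lt_N : m + size u < N by apply/ltnW/size_fib_pow.
have -> : N = m + (size u + (N - (m + size u))) by lia.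
rewrite /mkseq iotaD map_cat iotaD map_cat infix_catl // add0n.
rewrite {1}Du /mkseq -[in X in infix _ X](addn0 m) iotaDl -map_comp.
exact: prefix_infix.
Qed.

(** In the product topology continuity is checked coordinatewise, and a cylinder over the finite
    window [W i] is a neighbourhood. *)
Lemma local_code_continuous (A B : finType) (g : fullshift A -> fullshift B)
    (W : int -> seq int) :
  (forall x x' i, {in W i, x =1 x'} -> g x i = g x' i) -> continuous g.
Proof.
move=> g_local x; have Fg : Filter (g @ nbhs x) by apply: fmap_filter.
apply/(@cvg_sup _ _ _ _ _ Fg) => i U [V] [[O] oO <-] Ogx OU.
apply: (filterS OU).
have proj_x j : nbhs x [set x' : fullshift A | x' j = x j].
  have := @proj_continuous int (fun=> discrete_topology A) j x.
  by move=> /(_ _ (discrete_set1 (x j))).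
have : nbhs x [set x' : fullshift A | {in W i, x =1 x'}].
  elim: (W i) => [|j s IH]; first by apply: filterS filterT => x' _ j.
  apply: filterS (filterI (proj_x j) IH) => x' [eq_j eq_s] l.
  by rewrite inE => /predU1P[->|/eq_s].
by apply: filterS => x' /g_local eq_i; rewrite /= -eq_i.
Qed.

(** The rule of [doubled_code], recentred so that it inverts [undouble_code] exactly and not just up
    to a shift. *)
Definition double_code (x : fullshift bool) : fullshift bool :=
  fun i => [&& x (i - 1)%R, ~~ x i & ~~ x (i + 1)%R].

Definition undouble_code (y : fullshift bool) : fullshift bool :=
  fun i => y (i + 1)%R || (y (i + 3)%R && ~~ y i).

Lemma doubled_conjugate :
  topologically_conjugate fib_doubled_subshift (subst_subshift fib).
Proof.
exists undouble_code, double_code; rewrite /subst_subshift fib_language.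
have window (z : nat -> bool) x : subshift_of (seq_language z) x ->
    forall i n, exists m, forall k (l : int),
    (l = i + k%:Z)%R -> k < n -> x l = z (m + k).
  move=> /seq_subshiftP zx i n; have [m eq_m] := zx i n.
  by exists m => k _ ->; exact: eq_m.
split; first split.
- move=> y Yy; apply/seq_subshiftP => i n.
  have [m eq_m] := window _ y Yy i (n + 3); exists m => k lt_k.
  rewrite /undouble_code (eq_m k.+1 (i + k%:Z + 1)%R); [|lia|lia].
  rewrite (eq_m k.+3 (i + k%:Z + 3)%R); [|lia|lia].
  by rewrite (eq_m k (i + k%:Z)%R) ?[in RHS]fib_word_code ?addnS //; lia.
- move=> x Xx; apply/seq_subshiftP => i n.
  have [m eq_m] := window _ x Xx (i - 1)%R (n + 2); exists m.+1 => k lt_k.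
  rewrite /double_code (eq_m k (i + k%:Z - 1)%R); [|lia|lia].
  rewrite (eq_m k.+1 (i + k%:Z)%R); [|lia|lia].
  by rewrite (eq_m k.+2 (i + k%:Z + 1)%R) ?addSn ?doubled_code ?addnS //; lia.
- split.
    move=> y Yy; apply/funext => i.
    (* Either composite of the two codes at [i] reads the places [i - 1] to [i + 4]. *)
    have [m eq_m] := window _ y Yy (i - 1)%R 6.
    have w_at k l : (l = i - 1 + k%:Z)%R -> k < 3 ->
        undouble_code y l = fib_word (m + k).
      move=> Dl lt_k; rewrite /undouble_code (eq_m k.+1 (l + 1)%R); [|lia|lia].
      rewrite (eq_m k.+3 (l + 3)%R); [|lia|lia].
      by rewrite (eq_m k l) ?[in RHS]fib_word_code ?addnS //; lia.
    rewrite /double_code (w_at 0 (i - 1)%R); [|lia|lia].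
    rewrite (w_at 1 i); [|lia|lia]; rewrite (w_at 2 (i + 1)%R); [|lia|lia].
    by rewrite (eq_m 1 i) ?addn0 ?addn1 ?addn2 ?doubled_code //; lia.
  move=> x Xx; apply/funext => i.
  have [m eq_m] := window _ x Xx (i - 1)%R 6.
  have y_at k l : (l = i + k%:Z)%R -> k < 4 ->
      double_code x l = fib_doubled_word (m + k).+1.
    move=> Dl lt_k; rewrite /double_code (eq_m k (l - 1)%R); [|lia|lia].
    rewrite (eq_m k.+1 l); [|lia|lia].
    by rewrite (eq_m k.+2 (l + 1)%R) ?doubled_code ?addnS //; lia.
  rewrite /undouble_code (y_at 1 (i + 1)%R); [|lia|lia].
  rewrite (y_at 3 (i + 3)%R); [|lia|lia]; rewrite (y_at 0 i); [|lia|lia].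
  rewrite (eq_m 1 i); [|lia|lia].
  by rewrite [in RHS]fib_word_code addn0 !addnS addn0.
- apply: continuous_subspaceT.
  apply: (@local_code_continuous _ _ _ (fun i => [:: i; i + 1; i + 3]%R)).
  move=> y y' i eq_y.
  by rewrite /undouble_code !eq_y // !inE eqxx ?orbT.
- apply: continuous_subspaceT.
  apply: (@local_code_continuous _ _ _ (fun i => [:: i - 1; i; i + 1]%R)).
  move=> y y' i eq_y.
  by rewrite /double_code !eq_y // !inE eqxx ?orbT.
move=> y Yy; apply/funext => i; rewrite /undouble_code /shift.
by congr (y _ || (y _ && ~~ y _)); lia.
Qed.

(** * Uniform recurrence for primitive substitutions *)

Lemma subst_word_cat (A : finType) (theta : substitution A) u v :
  subst_word theta (u ++ v) = subst_word theta u ++ subst_word theta v.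
Proof. by rewrite /subst_word map_cat flatten_cat. Qed.

Lemma iter_subst_word_cat (A : finType) (theta : substitution A) k u v :
  iter k (subst_word theta) (u ++ v) =
  iter k (subst_word theta) u ++ iter k (subst_word theta) v.
Proof. by elim: k => //= k ->; rewrite subst_word_cat. Qed.

Lemma iter_subst_wordE (A : finType) (theta : substitution A) k s :
  iter k (subst_word theta) s = flatten (map (subst_pow theta k) s).
Proof.
elim: s => [|a s IH]; first by elim: k => //= k ->.
by rewrite -cat1s iter_subst_word_cat IH.
Qed.

Lemma infix_iter_subst (A : finType) (theta : substitution A) k u v :
  infix u v ->
  infix (iter k (subst_word theta) u) (iter k (subst_word theta) v).
Proof.
by case/infixP=> p [s ->]; rewrite !iter_subst_word_cat infix_infix.
Qed.

Lemma mem_infix1 (T : eqType) (a : T) s : a \in s -> infix [:: a] s.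
Proof. by case/splitPr => p q; rewrite -cat1s infix_infix. Qed.

(** The block containing the first letter of [v] covers at most [M] letters of [v], so the block
    after it ends within the first [M + M]. *)
Lemma infix_flatten_block (S T : eqType) (f : S -> seq T) M s v :
  (forall a, size (f a) <= M) -> 0 < M -> M + M <= size v ->
  infix v (flatten (map f s)) -> exists a, infix (f a) v.
Proof.
move=> leM M_gt0 le_v /infixP[p [q Dv]].
elim: s p Dv => [|a s IH] p /= Dv.
  by move/(congr1 size): Dv; rewrite !size_cat /=; lia.
have [le_ap|lt_pa] := leqP (size (f a)) (size p).
  apply: (IH (drop (size (f a)) p)).
  have := congr1 (drop (size (f a))) Dv; rewrite drop_size_cat // drop_cat.
  case: ltnP => // le_pa; have -> : size (f a) = size p by apply/anti_leq/andP.
  by rewrite subnn drop0 drop_size.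
case: s Dv {IH} => [|b s] /= Dv.
  by move/(congr1 size): Dv; have := leM a; rewrite !size_cat /=; lia.
exists b; have /= := congr1 (drop (size p)) Dv.
rewrite drop_cat lt_pa drop_size_cat // => Dv'.
have := congr1 (take (size (drop (size p) (f a)) + size (f b))) Dv'.
have le_ab : size (drop (size p) (f a)) + size (f b) <= size v.
  by have := leM a; have := leM b; rewrite size_drop; lia.
rewrite catA take_size_cat ?size_cat // takel_cat // => Dab.
rewrite -[v](cat_take_drop (size (drop (size p) (f a)) + size (f b))) -Dab.
by rewrite -catA infix_infix.
Qed.

Lemma primitive_pow_self (A : finType) (theta : substitution A) k t a :
  (forall b c : A, c \in subst_pow theta k b) ->
  a \in subst_pow theta (t * k) a.
Proof.
move=> prim; elim: t => [|t IH]; first by rewrite inE.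
rewrite mulSn /subst_pow iterD; have := infix_iter_subst theta k (mem_infix1 IH).
by case/infixP => p [q ->]; rewrite !mem_cat prim orbT.
Qed.

(** For [K = j + k], every theta^K(c) contains theta^j(a), hence [u]; a long enough word of the
    language contains some theta^K(c). *)
Lemma primitive_recurrent (A : finType) (theta : substitution A) u :
  primitive theta -> subst_language theta u ->
  exists N, forall v, subst_language theta v -> N <= size v -> infix u v.
Proof.
case=> k k_gt0 prim [j [a [_ infix_u]]].
pose K := j + k; pose M := (\max_b size (subst_pow theta K b)).+1.
exists (M + M) => v [i [b [_ infix_v]]] le_v.
suff [c] : exists c, infix (subst_pow theta K c) v.
  apply: infix_trans; apply: infix_trans infix_u _.
  by rewrite /K /subst_pow iterD; apply/infix_iter_subst/mem_infix1/prim.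
(* The exponent [i] may be below [K]; since [b] occurs in theta^(K * k)(b), it can be raised by
   [K * k], which is at least [K]. *)
apply: (@infix_flatten_block _ _ _ M (subst_pow theta (i + K * k - K) b)) => //.
  by move=> c; rewrite ltnW // ltnS; apply: leq_bigmax.
rewrite -iter_subst_wordE -iterD subnKC; last first.
  by rewrite (leq_trans _ (leq_addl _ _)) // leq_pmulr.
apply: infix_trans infix_v _; rewrite iterD.
exact/infix_iter_subst/mem_infix1/primitive_pow_self.
Qed.

(** * Excluding a primitive substitution *)

(** The limit along an ultrafilter of the sequence [z] recentred at [p n]; as [p n] tends to
    infinity, each window eventually avoids the arbitrary values that [absz] gives at negative
    places. *)
Lemma seq_limit_point (z : nat -> bool) (p : nat -> nat) :
  (forall n, n <= p n) ->
  exists x : fullshift bool, forall i n, exists N,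
    (0 <= (p N)%:Z + i)%R /\
    forall k, k < n -> x (i + k%:Z)%R = z (absz ((p N)%:Z + i)%R + k).
Proof.
move=> le_p; have [G [UG sub_G]] := @ultraFilterLemma nat \oo _.
pose zi n (i : int) := z (absz ((p n)%:Z + i)%R).
exists (fun i => `[< G [set n | zi n i] >]) => i n.
have G_x j : G [set N | `[< G [set n | zi n j] >] = zi N j].
  case: asboolP => [|nG].
    by apply: filterS => N /= ->.
  have [//|] := in_ultra_setVsetC [set n | zi n j] UG.
  by apply: filterS => N /= /negP/negbTE.
have G_window : G [set N | forall k, k < n ->
    `[< G [set n | zi n (i + k%:Z)%R] >] = zi N (i + k%:Z)%R].
  elim: n => [|n IH]; first by apply: filterS filterT.
  apply: filterS (filterI IH (G_x (i + n%:Z)%R)) => N /= [IHN eqN] k.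
  by rewrite ltnS leq_eqVlt => /predU1P[->|/IHN].
have G_large : G [set N | absz i <= N] by apply: sub_G; exists (absz i).
have [N [eqN leN]] := filter_ex (filterI G_window G_large).
have := le_p N; rewrite /= in leN => le_pN.
exists N; split; first by lia.
by move=> k /eqN ->; congr (z _); lia.
Qed.

(** The equality of subshifts constrains [eta] only through two-sided points, so 0000 has to be seen
    in one of them. *)
Lemma doubled_point_0000 :
  exists2 x, fib_doubled_subshift x & subword x 0%R 4 = nseq 4 false.
Proof.
(* The Fibonacci word has a 1 at [cut 2 n + 1]; its block 00 and the first two letters of the next
   block form 0000. *)
pose p n := cut 2 (cut 2 n + 1).
have le_p n : n <= p n.
  have := @leq_cut_add 2 0 n isT.
  by have := @leq_cut_add 2 0 (cut 2 n + 1) isT; rewrite !add0n /p; lia.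
have y_p n k : k < 4 -> fib_doubled_word (p n + k) = false.
  have w1 : fib_word (cut 2 n + 1) by rewrite fib_word_cut2 //; lia.
  have := cutS 2 (cut 2 n + 1); rewrite -/(p n) w1 => Dp.
  case: k => [|[|k]] lt_k.
  - by rewrite doubled_cut2 ?w1.
  - by rewrite doubled_cut2 ?w1.
  have -> : p n + k.+2 = cut 2 (cut 2 n + 1).+1 + k by lia.
  by rewrite doubled_cut2; lia.
have [x x_lim] := seq_limit_point fib_doubled_word le_p; exists x.
  apply/seq_subshiftP => i n; have [N [_ eqN]] := x_lim i n.
  by exists (absz ((p N)%:Z + i)%R).
have [N [_ eqN]] := x_lim 0%R 4; rewrite GRing.addr0 in eqN.
by rewrite /subword /mkseq [LHS]/= !eqN // !y_p.
Qed.

Lemma doubled_no_word_power u :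
  true \in u -> ~ seq_language fib_doubled_word (u ++ u ++ u ++ u).
Proof.
move=> u1 [m Du]; set u4 := (u ++ _) in Du; pose n := size u.
have size4 : size u4 = n + n + n + n by rewrite !size_cat; lia.
have yE i : i < size u4 -> fib_doubled_word (m + i) = nth false u4 i.
  by move=> lt_i; rewrite Du nth_mkseq.
apply: (@doubled_no_power m n).
  exists (index true u); rewrite ?index_mem // yE; last first.
    by rewrite size4; move: u1; rewrite -index_mem -/n; lia.
  by rewrite nth_cat index_mem u1 nth_index.
move=> i lt_i; rewrite -addnA !yE ?size4; [|lia|lia].
rewrite [in RHS]nth_cat -/n (_ : i + n < n = false) ?addnK; last by lia.
by rewrite /u4 !catA [LHS]nth_cat !size_cat -/n (_ : i < _) //; lia.
Qed.

Theorem mainTheorem5 :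
  topologically_conjugate fib_doubled_subshift (subst_subshift fib) /\
  ~ (exists eta : substitution bool,
       primitive eta /\ subst_subshift eta = fib_doubled_subshift).
Proof.
split; first exact: doubled_conjugate.
case=> eta [prim_eta eta_Y].
have [x Yx x0000] := doubled_point_0000.
have eta_x i n : subst_language eta (subword x i n).
  by rewrite -eta_Y in Yx; apply: Yx.
have [k k_gt0 prim_k] := prim_eta.
pose u := subst_pow eta k false.
have eta_u4 : subst_language eta (u ++ u ++ u ++ u).
  have [j [a [j_gt0 infix_j]]] := eta_x 0%R 4; rewrite x0000 in infix_j.
  exists (k + j), a; split; first by rewrite addn_gt0 j_gt0 orbT.
  have := infix_iter_subst eta k infix_j.
  by rewrite iter_subst_wordE /= cats0 /subst_pow iterD.
(* So far the fourth power is only in the language of [eta]; recurrence places it inside a long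
   subword of [x], hence in the doubled word. *)
have [N infix_N] := primitive_recurrent prim_eta eta_u4.
apply: (@doubled_no_word_power u); first exact: prim_k.
apply: seq_language_infix (infix_N _ (eta_x 0%R N) _) (Yx 0%R N).
by rewrite size_mkseq.
Qed.
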